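(* Let $X$ be a regular Lindelöf space. Let $H$ be a closed $z$-ideal in $C_b(X)$ with empty hull. Then $H$ is isometrically isomorphic to $C_0(Y)$ for the locally compact Hausdorff space $Y$ given by \[Y=\bigcup\big\{\mathrm{int}_{\beta X}\mathrm{cl}_{\beta X}\mathrm{coz}(h):h\in H\big\},\] considered as a subspace of $\beta X$. Furthermore: (i) $X$ is dense in $Y$ (in particular $X\subseteq Y$). (ii) $C_0(Y)=C_{00}(Y)$; in particular, $Y$ is countably compact. (iii) $Y$ is compact if and only if $H$ is unital.
   Context: Regular spaces are taken to be Hausdorff (so regular Lindelöf spaces are normal Hausdorff), and $\beta X$ is the Stone–Čech compactification of $X$, containing $X$ as a dense subspace. $C_b(X)$ is the normed algebra of continuous bounded $f:X\to\mathbb{R}$ with pointwise operations and the supremum norm. $\mathrm{z}(f)=f^{-1}(0)$ and $\mathrm{coz}(f)=X\setminus\mathrm{z}(f)$. An ideal $H$ of $C_b(X)$ is a $z$-ideal if $f\in H$ whenever $f\in C_b(X)$ and $\mathrm{z}(f)=\mathrm{z}(h)$ for some $h\in H$; it has empty hull if $\bigcap\{\mathrm{z}(h):h\in H\}=\emptyset$. ''Closed'' means closed in $C_b(X)$. $C_0(Y)$ is the set of continuous bounded $f:Y\to\mathbb{R}$ with $|f|^{-1}([1/n,\infty))$ compact for each positive integer $n$, and $C_{00}(Y)$ the set of those with compact support. ''Isometrically isomorphic'' means by an isometric algebra isomorphism. A space is countably compact if every countable open cover has a finite subcover. An algebra is unital if it has a multiplicative unit element. *)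

(* Defs.v *)
From HB Require Import structures.
From mathcomp Require Import all_boot all_order all_algebra.
From mathcomp Require Import all_classical all_reals all_analysis.

Set Implicit Arguments.
Unset Strict Implicit.
Unset Printing Implicit Defensive.

Import Order.TTheory GRing.Theory Num.Theory.
Import numFieldNormedType.Exports.

Local Open Scope classical_set_scope.
Local Open Scope ring_scope.

Section covering_properties.
Variable T : topologicalType.

Definition lindelof_space : Prop :=
  forall F : set (set T), F `<=` open -> \bigcup_(U in F) U = setT ->
  exists G : set (set T),
    [/\ G `<=` F, countable G & \bigcup_(U in G) U = setT].

Definition countably_compact_space : Prop :=
  forall F : set (set T), countable F -> F `<=` open ->
  \bigcup_(U in F) U = setT ->
  exists G : set (set T),
    [/\ G `<=` F, finite_set G & \bigcup_(U in G) U = setT].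

End covering_properties.

(* Subalgebras of C_b(X) are represented as sets of functions [X -> R]; the
   operations [+], [*], [*:] are the pointwise ones on [X -> R]. *)
Section function_algebras.
Variables (R : realType) (X : topologicalType).
Implicit Types (f g h : X -> R) (H : set (X -> R)).

Definition Cb : set (X -> R) := [set f | continuous f /\ bounded_fun f].

(* [sup set0 = 0], so the norm is also correct when [X] is empty. *)
Definition sup_norm f : R := sup (range (fun x => `|f x|)).

Definition zero_set f : set X := f @^-1` [set 0].

Definition coz f : set X := ~` zero_set f.

(* Closure under scalar multiples and opposites follows from absorption of the
   constant functions. *)
Record Cb_ideal H : Prop := {
  Cb_ideal_sub : H `<=` Cb;
  Cb_ideal0 : H 0;
  Cb_idealD : forall f g, H f -> H g -> H (f + g);
  Cb_idealM : forall f h, Cb f -> H h -> H (f * h) }.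

Definition z_ideal H : Prop :=
  Cb_ideal H /\
  forall f, Cb f -> (exists2 h, H h & zero_set f = zero_set h) -> H f.

Definition empty_hull H : Prop := \bigcap_(h in H) zero_set h = set0.

Definition closed_in_Cb H : Prop :=
  forall f, Cb f ->
  (forall eps : R, 0 < eps -> exists2 h, H h & sup_norm (f - h) < eps) ->
  H f.

Definition unital H : Prop :=
  exists2 u, H u & forall f, H f -> u * f = f /\ f * u = f.

Definition C0 : set (X -> R) :=
  [set f | Cb f /\
    forall n : nat, (0 < n)%N -> compact [set x | n%:R^-1 <= `|f x|]].

Definition C00 : set (X -> R) :=
  [set f | Cb f /\ compact (closure (coz f))].

End function_algebras.

Arguments C0 : clear implicits.
Arguments C00 : clear implicits.

Record isometric_alg_iso (R : realType) (X Y : topologicalType)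
    (A : set (X -> R)) (B : set (Y -> R)) (T : (X -> R) -> (Y -> R)) : Prop := {
  alg_iso_bij : set_bij A B T;
  alg_isoD : forall f g, A f -> A g -> T (f + g) = T f + T g;
  alg_isoM : forall f g, A f -> A g -> T (f * g) = T f * T g;
  alg_isoZ : forall (a : R) f, A f -> T (a *: f) = a *: T f;
  alg_iso_norm : forall f, A f -> sup_norm (T f) = sup_norm f }.

Definition isometrically_isomorphic (R : realType) (X Y : topologicalType)
    (A : set (X -> R)) (B : set (Y -> R)) : Prop :=
  exists T, isometric_alg_iso A B T.

(* [e : X -> K] exhibits [K] as the Stone-Cech compactification of [X]: a
   Hausdorff compactification to which every bounded continuous real function
   on [X] extends.  This determines [(K, e)] up to homeomorphism over [X]. *)
Record is_stone_cech (R : realType) (X K : topologicalType) (e : X -> K) :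
    Prop := {
  stone_cech_compact : compact [set: K];
  stone_cech_hausdorff : hausdorff_space K;
  stone_cech_inj : injective e;
  stone_cech_topology : forall U : set X,
    open U <-> exists2 V : set K, open V & U = e @^-1` V;
  stone_cech_dense : dense (range e);
  stone_cech_extend : forall f : X -> R, Cb f ->
    exists2 g : K -> R, continuous g & forall x, g (e x) = f x }.

(* The image [e @` coz h] stands for [coz h] regarded as a subset of the
   Stone-Cech compactification. *)
Definition beta_coz (R : realType) (X K : topologicalType) (e : X -> K)
    (H : set (X -> R)) : set K :=
  \bigcup_(h in H) interior (closure (e @` coz h)).

(* Main.v *)
Require Import Defs.
From HB Require Import structures.
From mathcomp Require Import all_boot all_order all_algebra.
From mathcomp Require Import all_classical all_reals all_analysis.
From mathcomp Require Import ring lra.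
Import Order.TTheory GRing.Theory Num.Theory.
Import numFieldNormedType.Exports.
Local Open Scope classical_set_scope.
Local Open Scope ring_scope.

(** The hypotheses force the ideal [H] to be the whole algebra [Cb].

    Membership in a z-ideal depends only on the cozero set, and when the ideal
    is closed its cozero sets are stable under countable unions
    ([z_ideal_bigcup_coz]): if [h n] lies in [H] for all [n], then truncating
    [|h n|] at [2 ^- n] keeps it in [H] and makes the series of the truncations
    converge uniformly, so that its sum lies in [H] and vanishes exactly where
    all the [h n] vanish.  Empty hull says that the cozero sets of members of
    [H] cover [X]; as [X] is Lindelof, countably many of them do, hence some
    member of [H] vanishes nowhere.  It has the zero set of the constant [1],
    so [1] lies in [H] and [H = Cb] ([z_ideal_lindelof_eq_Cb]).

    Since the cozero set of [1] is [X], dense in its compactification, the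
    space [Y] is then the whole Stone-Cech compactification ([beta_coz_Cb]).
    On a compact space the bounded continuous functions, those vanishing at
    infinity and those of compact support are all the continuous functions, so
    every topological assertion is immediate.  The isomorphism of [H] with
    [C0 R Y] is the extension of functions, whose inverse is the restriction
    to the dense subspace [X] ([extension_isom]). *)

Lemma countable_subset_range {T} {A B : set T} : countable A -> A `<=` B ->
  B !=set0 -> exists u : nat -> T, A `<=` range u /\ range u `<=` B.
Proof.
move=> /pfcard_geP[->|[u]] AB [b Bb].
  by exists (fun=> b); split=> [x []|_ [n _ <-]].
by exists u; rewrite image_eq; split.
Qed.

(** * Algebra and norm of bounded continuous functions *)

Section C_b.
Context {R : realType} {X : topologicalType}.
Implicit Types (f g h : X -> R) (H : set (X -> R)).

Lemma bounded_fun_exP f : bounded_fun f <-> exists M, forall x, `|f x| <= M.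
Proof.
split=> [[M [_ fM]]|[M fM]].
  by exists (M + 1) => x; apply: fM => //; rewrite ltrDl.
by exists M; split=> [|N /ltW MN x _]; [exact: num_real|exact: le_trans MN].
Qed.

Lemma sup_norm_le f c : 0 <= c -> (forall x, `|f x| <= c) -> sup_norm f <= c.
Proof.
move=> c0 fc; rewrite /sup_norm.
have [->|/set0P fX] := eqVneq (range (fun x => `|f x|)) set0.
  by rewrite sup0.
by apply: ge_sup => // _ [x _ <-].
Qed.

Lemma norm_le_sup_norm {f} x : bounded_fun f -> `|f x| <= sup_norm f.
Proof.
move=> /bounded_fun_exP[M fM]; apply: ub_le_sup; last by exists x.
by exists M => _ [y _ <-].
Qed.

Lemma sup_norm_ge0 f : bounded_fun f -> 0 <= sup_norm f.
Proof.
have [f0 _|/set0P[_ [x _ _]] fb] := eqVneq (range (fun x => `|f x|)) set0.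
  by rewrite /sup_norm f0 sup0.
by rewrite (le_trans _ (norm_le_sup_norm x fb)).
Qed.

Lemma Cb_cst (a : R) : Cb (cst a : X -> R).
Proof.
split; first exact: cst_continuous.
by apply/bounded_fun_exP; exists `|a|.
Qed.

Lemma CbD f g : Cb f -> Cb g -> Cb (f + g).
Proof.
move=> [fc fb] [gc gb]; split; last exact: bounded_funD.
by move=> x; apply: continuousD; [exact: fc|exact: gc].
Qed.

Lemma CbM f g : Cb f -> Cb g -> Cb (f * g).
Proof.
move=> [fc fb] [gc gb]; split.
  by move=> x; apply: continuousM; [exact: fc|exact: gc].
apply/bounded_fun_exP; exists (sup_norm f * sup_norm g) => x.
by rewrite normrM ler_pM// norm_le_sup_norm.
Qed.

Lemma open_coz h : continuous h -> open (coz h).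
Proof.
move=> hc; rewrite openC; apply: preimage_closed => [x _|].
  exact: hc.
exact: closed_eq.
Qed.

(** A uniform limit of continuous functions is continuous: the usual
    three-epsilon argument. *)
Lemma continuous_approx f :
  (forall eps : R, 0 < eps ->
    exists2 g, continuous g & forall x, `|f x - g x| <= eps) ->
  continuous f.
Proof.
move=> fapp x; apply/cvgrPdist_le => eps eps0.
have e3 : 0 < eps / 3 by rewrite divr_gt0.
have [g gc fg] := fapp _ e3.
have /cvgrPdist_le/(_ _ e3) := gc x; apply: filterS => y gxy.
have -> : f x - f y = (f x - g x) + (g x - g y) - (f y - g y) by ring.
have -> : eps = eps / 3 + eps / 3 + eps / 3 by field.
rewrite (le_trans (ler_normB _ _))// lerD// (le_trans (ler_normD _ _))//.
by rewrite lerD.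
Qed.

(** * Cozero sets of a closed z-ideal *)

Section ideal.
Context {H} (zH : z_ideal H).

Let pow2N_gt0 n : (0 : R) < 2 ^- n. Proof. by rewrite invr_gt0 exprn_gt0. Qed.

(** Truncation at a positive level does not change the zero set. *)
Lemma z_ideal_truncate h (c : R) : 0 < c -> H h ->
  H (fun x => Num.min `|h x| c).
Proof.
move=> c0 Hh; have [IH zcl] := zH; have [hc _] := Cb_ideal_sub IH Hh.
apply: zcl.
  split; last first.
    apply/bounded_fun_exP; exists c => x.
    by rewrite ger0_norm ?ge_min ?lexx ?orbT// le_min normr_ge0 ltW.
  move=> x; apply: (@continuous_min R X (fun x => `|h x|) (fun=> c));
    last exact: cst_continuous.
  by apply: continuous_comp; [exact: hc|exact: norm_continuous].
exists h => //; apply/seteqP; split=> x; rewrite /zero_set/=.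
  rewrite /Num.min; case: ifP => _ => [/normr0_eq0//|E].
  by rewrite E ltxx in c0.
by move=> ->; rewrite normr0 min_l// ltW.
Qed.

(** The witness is the sum of the series of the [h n] truncated at [2 ^- n].
    Its terms are nonnegative, so the sum is obtained as the supremum of the
    partial sums, and it vanishes only where every term does. *)
Lemma z_ideal_bigcup_coz (h : nat -> X -> R) : closed_in_Cb H ->
  (forall n, H (h n)) -> exists2 g, H g & coz g = \bigcup_n coz (h n).
Proof.
move=> clH Hh; have [IH _] := zH.
pose m n x := Num.min `|h n x| (2 ^- n).
pose S n x := \sum_(i < n) m i x.
have m0 n x : 0 <= m n x by rewrite le_min normr_ge0 ltW.
have SS n x : S n.+1 x = S n x + m n x by rewrite /S big_ord_recr.
have HS n : H (S n).
  elim: n => [|n IHn].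
    rewrite (_ : S 0%N = 0); first exact: Cb_ideal0.
    by apply/funext => x; rewrite /S big_ord0.
  rewrite (_ : S n.+1 = S n + m n); last by apply/funext=> x; exact: SS.
  by apply: (Cb_idealD IH) => //; exact: z_ideal_truncate.
(* The partial sums increase, whereas adding to them the bound [2 * 2 ^- n] on
   the tail of the geometric series makes them decrease: this compares any two
   of them, in either order of the indices. *)
have Sle k n x : S k x <= S n x + 2 * 2 ^- n.
  have [kn|/ltnW nk] := leqP k n.
    apply: (@le_trans _ _ (S n x)); last by rewrite lerDl mulr_ge0// ltW.
    have /nondecreasing_seqP : forall i, S i x <= S i.+1 x.
      by move=> i; rewrite SS lerDl.
    exact.
  apply: (@le_trans _ _ (S k x + 2 * 2 ^- k)).
    by rewrite lerDl mulr_ge0// ltW.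
  have /nonincreasing_seqP :
      forall i, S i.+1 x + 2 * 2 ^- i.+1 <= S i x + 2 * 2 ^- i.
    move=> i; have : m i x <= 2 ^- i by rewrite ge_min lexx orbT.
    rewrite SS exprS invfM; have := pow2N_gt0 i; lra.
  exact.
pose g x := sup (range (S ^~ x)).
have Sg n x : S n x <= g x.
  apply: ub_le_sup; last by exists n.
  by exists (S 0%N x + 2 * 2 ^- 0) => _ [k _ <-].
have gS n x : g x <= S n x + 2 * 2 ^- n.
  by apply: ge_sup => [|_ [k _ <-]//]; exists (S n x), n.
have gSn n x : `|g x - S n x| <= 2 * 2 ^- n.
  by rewrite ger0_norm ?subr_ge0// lerBlDl.
have small (eps : R) : 0 < eps -> exists n, 2 * 2 ^- n < eps :> R.
  move=> eps0.
  have /cvgr0_norm_lt/(_ _ eps0)[n _ /(_ n (leqnn _))] :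
      geometric (2 : R) 2^-1 @ \oo --> 0.
    by apply: cvg_geometric; rewrite ger0_norm// invf_lt1// ltr1n.
  rewrite /= exprVn ger0_norm; first by exists n.
  by rewrite mulr_ge0// ltW.
exists g.
  apply: clH.
    split.
      apply: continuous_approx => eps /small[n /ltW neps].
      exists (S n) => [|x]; first by have [] := Cb_ideal_sub IH (HS n).
      exact: le_trans neps.
    (* The partial sum of index 0 is zero, so its distance bounds the sum. *)
    apply/bounded_fun_exP; exists 2 => x; have := gSn 0%N x.
    by rewrite /S big_ord0 subr0 expr0 invr1 mulr1.
  move=> eps /small[n neps]; exists (S n) => //.
  apply: le_lt_trans neps; apply: sup_norm_le => [|x]; last exact: gSn.
  by rewrite mulr_ge0// ltW.
apply/seteqP; split=> x; rewrite /coz /zero_set/=.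
  move=> gx; apply: contra_notP gx => hx; apply/le_anti.
  rewrite (le_trans _ (Sg 0%N x)) ?andbT; last by rewrite /S big_ord0.
  apply: ge_sup => [|_ [n _ <-]]; first by exists (S 0%N x), 0%N.
  rewrite /S big1// => i _; rewrite /m.
  have -> : h i x = 0 by apply: contrapT => hix; apply: hx; exists i.
  by rewrite normr0 min_l// ltW.
move=> [n _ hx] gx; apply: hx.
apply/normr0_eq0/le_anti; rewrite normr_ge0 andbT.
have : m n x <= 0.
  rewrite -gx (le_trans _ (Sg n.+1 x))// SS lerDr.
  by rewrite /S sumr_ge0.
by rewrite ge_min [2 ^- n <= 0]leNgt pow2N_gt0 orbF.
Qed.

(** By the Lindelof property a countable union of cozero sets of members of [H]
    is [X], so some member has the empty zero set, which is that of [1]. *)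
Lemma z_ideal_lindelof_eq_Cb : lindelof_space X -> closed_in_Cb H ->
  empty_hull H -> H = @Cb R X.
Proof.
move=> lindX clH hullH; have [IH zcl] := zH.
have [||G [GF cG GT]] := lindX [set coz h | h in H].
- by move=> _ [h Hh <-]; apply: open_coz; have [] := Cb_ideal_sub IH Hh.
- apply/seteqP; split=> // x _; apply: contrapT => xU.
  suff : (\bigcap_(h in H) zero_set h) x by rewrite hullH.
  move=> h Hh; apply: contrapT => hx.
  by apply: xU; exists (coz h) => //; exists h.
(* The subcover may be empty (when [X] is); the cozero set of [0] then serves as
   the value of the enumeration. *)
have [|u [Gu uF]] := countable_subset_range cG GF.
  by exists (coz (0 : X -> R)), 0 => //; exact: Cb_ideal0.
have /choice[h hu] n : exists h, H h /\ coz h = u n.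
  by have [|h Hh hn] := uF (u n); [exists n|exists h].
have [n|g Hg gE] := z_ideal_bigcup_coz h clH; first by have [] := hu n.
have H1 : H 1.
  apply: zcl; last exists g => //.
    exact: Cb_cst.
  apply: setC_inj; rewrite -/(coz 1) -/(coz g) gE; apply/seteqP; split=> x _.
    have [U /Gu[n _ <-] Ux] : (\bigcup_(U in G) U) x by rewrite GT.
    by exists n => //; have [_ ->] := hu n.
  by rewrite /coz/zero_set /=; apply/eqP/oner_neq0.
apply/seteqP; split=> f fC; first exact: (Cb_ideal_sub IH).
by rewrite -[f]mulr1; exact: Cb_idealM.
Qed.

End ideal.
End C_b.

(** * Function algebras of a compact space *)

Section compact_space.
Context {R : realType} {Y : topologicalType} (cptY : compact [set: Y]).
Implicit Types g : Y -> R.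

Let closed_compact (A : set Y) : closed A -> compact A.
Proof. by move=> cA; exact: subclosed_compact cptY _. Qed.

Lemma compact_CbE : @Cb R Y = [set g | continuous g].
Proof.
apply/seteqP; split=> g /= => [[]//|gc]; split=> //.
have [|M [_ gM]] := @compact_bounded R R^o (range g).
  by apply: continuous_compact => //; exact: continuous_subspaceT.
apply/bounded_fun_exP; exists (M + 1) => y.
by apply: gM; [rewrite ltrDl|exists y].
Qed.

Lemma compact_C0E : C0 R Y = [set g | continuous g].
Proof.
rewrite -compact_CbE; apply/seteqP; split=> [g []|g gC] //.
split=> // n _; apply: closed_compact.
have gc : continuous g by case: gC.
apply: (@preimage_closed _ _ (fun y => `|g y|) [set r | n%:R^-1 <= r]).
  by move=> y _; apply: continuous_comp; [exact: gc|exact: norm_continuous].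
exact: closed_ge.
Qed.

Lemma compact_C00E : C00 R Y = [set g | continuous g].
Proof.
rewrite -compact_CbE; apply/seteqP; split=> [g []|g gC] //.
by split=> //; apply/closed_compact/closed_closure.
Qed.

(** For an enumeration [u] of the cover, the property that one of the sets
    [u 0], ..., [u n] contains [y] holds for [n] large, locally uniformly in
    [y], hence uniformly by compactness. *)
Lemma compact_countably_compact : countably_compact_space Y.
Proof.
move=> F cF Fopen FY; have [F0|/set0P F0] := eqVneq F set0.
  by exists F; split=> //; rewrite F0.
have [u [Fu uF]] := countable_subset_range cF (@subset_refl _ F) F0.
have : \forall n \near \oo,
    [set: Y] `<=` (fun y => exists2 k, (k <= n)%N & u k y).
  apply: (compact_near_coveringP _).1 => // y _.
  have [U /Fu[k _ <-] uky] : (\bigcup_(U in F) U) y by rewrite FY.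
  exists (u k, [set n | (k <= n)%N]); last by move=> [z n] /= [? ?]; exists k.
  split=> /=; last exact: nbhs_infty_ge.
  by apply: open_nbhs_nbhs; split=> //; apply/Fopen/uF; exists k.
move=> [n _ /(_ n (leqnn n)) nY]; exists (u @` `I_n.+1); split.
- by move=> _ [k _ <-]; apply: uF; exists k.
- exact/finite_image/finite_II.
- by apply/seteqP; split=> // y /nY[k kn uky]; exists (u k).
Qed.

Lemma compact_locally_compact : locally_compact [set: Y].
Proof.
move=> y _; exists setT; first exact: filterT.
by split=> //; exact: closedT.
Qed.

End compact_space.

(** * Extension of functions from a dense subspace *)

Section dense_image.
Context {R : realType} {X Y : topologicalType} {j : X -> Y}.
Hypothesis jY : dense (range j).
Implicit Types g : Y -> R.

Lemma dense_norm_le g c : continuous g ->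
  (forall x, `|g (j x)| <= c) -> forall y, `|g y| <= c.
Proof.
move=> gc gjc y; apply: contrapT => gyc.
have [||z [/= gzc [x _ xz]]] := jY [set y | ~ `|g y| <= c].
- by exists y.
- rewrite openC.
  apply: (@preimage_closed _ _ (fun y => `|g y|) [set r | r <= c]).
    by move=> z _; apply: continuous_comp; [exact: gc|exact: norm_continuous].
  exact: closed_le.
- by apply: gzc; rewrite -xz.
Qed.

Lemma dense_continuous_inj g1 g2 : continuous g1 -> continuous g2 ->
  (forall x, g1 (j x) = g2 (j x)) -> g1 = g2.
Proof.
move=> c1 c2 g12; apply/funext => y; apply/eqP; rewrite -subr_eq0 -normr_le0.
apply: (@dense_norm_le (g1 - g2)) => [z|x].
  by apply: continuousB; [exact: c1|exact: c2].
by rewrite /= !fctE g12 subrr normr0.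
Qed.

Lemma dense_sup_norm g : bounded_fun g -> continuous g ->
  sup_norm (g \o j) = sup_norm g.
Proof.
move=> gb gc; have gjb : bounded_fun (g \o j).
  have /bounded_fun_exP[M gM] := gb.
  by apply/bounded_fun_exP; exists M => x; exact: gM.
apply/le_anti/andP; split; apply: sup_norm_le; rewrite ?sup_norm_ge0//.
  by move=> x; exact: (norm_le_sup_norm (j x) gb).
by apply: dense_norm_le => // x; exact: (norm_le_sup_norm x gjb).
Qed.

(** Extensions are unique by density, so extending functions inverts the
    restriction [g |-> g \o j].  The latter preserves the pointwise operations,
    hence so does its inverse; density of the image makes it isometric. *)
Lemma extension_isom : compact [set: Y] -> continuous j ->
  (forall f : X -> R, Cb f ->
    exists2 g : Y -> R, continuous g & forall x, g (j x) = f x) ->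
  isometrically_isomorphic (@Cb R X) (C0 R Y).
Proof.
move=> cptY jc ext; rewrite (compact_C0E cptY).
have /choice[E EP] (f : X -> R) : exists g, Cb f -> continuous g /\ g \o j = f.
  have [/ext[g gc gj]|nf] := pselect (Cb f); last by exists 0.
  by exists g => _; split=> //; exact/funext.
have Euniq f g : Cb f -> continuous g -> g \o j = f -> E f = g.
  move=> /EP[Ec Ej] gc gj; apply: dense_continuous_inj => // x.
  by rewrite -[E f _]/((E f \o j) x) Ej -gj.
exists E; split.
- split.
  + by move=> f /EP[].
  + by move=> f1 f2 /set_mem/EP[_ j1] /set_mem/EP[_ j2] E12; rewrite -j1 E12.
  + move=> g gc; have [_ gb] : Cb g by rewrite compact_CbE.
    have gjC : Cb (g \o j).
      split; first by move=> x; apply: continuous_comp; [exact: jc|exact: gc].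
      have /bounded_fun_exP[M gM] := gb.
      by apply/bounded_fun_exP; exists M => x; exact: gM.
    by exists (g \o j) => //; exact: Euniq.
- move=> f1 f2 /[dup]/EP[c1 j1] C1 /[dup]/EP[c2 j2] C2.
  apply: Euniq; first exact: CbD.
    by move=> y; apply: continuousD; [exact: c1|exact: c2].
  by rewrite -{2}j1 -{2}j2.
- move=> f1 f2 /[dup]/EP[c1 j1] C1 /[dup]/EP[c2 j2] C2.
  apply: Euniq; first exact: CbM.
    by move=> y; apply: continuousM; [exact: c1|exact: c2].
  by rewrite -{2}j1 -{2}j2.
- move=> a f /[dup]/EP[fc fj] fC.
  apply: Euniq; first exact: (CbM (cst a) f (Cb_cst a) fC).
    by move=> y; apply: continuousM; [exact: cst_continuous|exact: fc].
  by rewrite -{2}fj.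
- move=> f /EP[Ec Ej]; rewrite -{2}Ej dense_sup_norm//.
  by have [] : Cb (E f) by rewrite compact_CbE.
Qed.

End dense_image.

(** * Subspaces *)

Section subspace.
Context {K : topologicalType} {B : set K}.

Lemma set_type_nbhs (y : set_type B) (U : set (set_type B)) : nbhs y U ->
  exists2 V : set K, nbhs (set_val y) V & set_val @^-1` V `<=` U.
Proof.
move=> [_ [[V Vo <-] Vy] VU]; exists V => //.
exact: open_nbhs_nbhs.
Qed.

Lemma set_val_continuous : continuous (set_val : set_type B -> K).
Proof. exact: initial_continuous. Qed.

Lemma set_type_hausdorff : hausdorff_space K -> hausdorff_space (set_type B).
Proof.
move=> hK p q pq; apply: val_inj; apply: hK => U V Up Vq.
have [z [Uz Vz]] := pq _ _ (set_val_continuous p U Up)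
  (set_val_continuous q V Vq).
by exists (set_val z).
Qed.

(** A filter on the subtype is pushed forward to the ambient space, where it
    contains [B]; a cluster point in [B] is a cluster point of the filter. *)
Lemma set_type_compact : compact B -> compact [set: set_type B].
Proof.
move=> cB F FF _; have FB : (set_val @ F) B.
  by apply: (@filterS _ F _ setT) => [y _|]; [exact: set_valP|exact: filterT].
have [p [Bp clp]] := cB _ _ FB.
exists (SigSub (mem_set Bp)); split=> // A U FA /set_type_nbhs[V Vp VU].
have [|_ [[y Ay <-] Vy]] := clp (set_val @` A) V _ Vp.
  by apply: (@filterS _ F _ A) => // y Ay; exists y.
by exists y; split=> //; exact: VU.
Qed.

End subspace.

(** * The Stone-Cech compactification *)

Section stone_cech.
Context {R : realType} {X K : topologicalType} {e : X -> K}.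
Hypothesis betaX : is_stone_cech R e.

Lemma stone_cech_continuous : continuous e.
Proof.
by apply/continuousP => V Vo; apply/(stone_cech_topology betaX); exists V.
Qed.

(** The constant [1] alone contributes the interior of the closure of [X],
    that is, the whole compactification. *)
Lemma beta_coz_Cb : beta_coz e (@Cb R X) = setT.
Proof.
apply/seteqP; split=> // y _; exists (cst 1); first exact: Cb_cst.
have -> : coz (cst 1 : X -> R) = setT.
  apply/seteqP; split=> // x _.
  by rewrite /coz /zero_set /=; exact/eqP/oner_neq0.
suff -> : closure (range e) = setT by rewrite interiorT.
apply/seteqP; split=> // z _ U; rewrite nbhsE => -[V [Vo Vz] VU].
have [w [Vw [x _ xw]]] := stone_cech_dense betaX (ex_intro _ z Vz) Vo.
by exists w; split; [exists x|exact: VU].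
Qed.

End stone_cech.

Theorem theorem5p5 (R : realType) (X : topologicalType)
  (hausX : hausdorff_space X) (regX : @regular_space X)
  (lindX : lindelof_space X)
  (K : topologicalType) (e : X -> K) (betaX : is_stone_cech R e)
  (H : set (X -> R)) (zH : z_ideal H) (clH : closed_in_Cb H)
  (hullH : empty_hull H) :
  let Y : topologicalType := set_type (beta_coz e H) in
  [/\ hausdorff_space Y /\ locally_compact [set: Y],
      isometrically_isomorphic H (C0 R Y),
      range e `<=` beta_coz e H /\ dense [set y : Y | range e (set_val y)],
      C0 R Y = C00 R Y /\ countably_compact_space Y
    & compact [set: Y] <-> unital H].
Proof.
move=> Y; have HE := z_ideal_lindelof_eq_Cb zH lindX clH hullH.
have YT : beta_coz e H = setT by rewrite HE (beta_coz_Cb betaX).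
have Yall z : z \in beta_coz e H by rewrite YT in_setT.
have cptY : compact [set: Y].
  by apply: set_type_compact; rewrite YT; exact: stone_cech_compact betaX.
pose j x : Y := SigSub (Yall (e x)).
have jc : continuous j.
  by apply: continuous_comp_initial; exact: (stone_cech_continuous betaX).
have jY : dense (range j).
  move=> O [y Oy] [V Vo VO].
  have Vy : V (set_val y) by move: Oy; rewrite -VO.
  have [z [Vz [x _ xz]]] := stone_cech_dense betaX (ex_intro _ _ Vy) Vo.
  by rewrite -xz in Vz; rewrite -VO; exists (j x); split=> //; exists x.
split.
- split; last exact: compact_locally_compact.
  exact: set_type_hausdorff (stone_cech_hausdorff betaX).
- rewrite [X in isometrically_isomorphic X _]HE.
  apply: (extension_isom jY) => // f /(stone_cech_extend betaX)[g gc ge].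
  exists (g \o set_val) => // y.
  by apply: continuous_comp; [exact: set_val_continuous|exact: gc].
- split; first by rewrite YT.
  move=> V V0 Vo; have [z [Vz [x _ xz]]] := jY V V0 Vo.
  by exists z; split=> //; exists x; rewrite // -xz.
- rewrite compact_C0E// compact_C00E//; split=> //.
  exact: compact_countably_compact.
- split=> // _; exists 1; first by rewrite HE; exact: Cb_cst.
  by move=> f _; rewrite mul1r mulr1.
Qed.
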